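(* Let $s\neq0$ be real. The Kepler system in the plane $\mathbb{C}$ with the flat metric and force function $\frac{s}{|q|}$, with all energies in $\mathbb{R}$ allowed, admits any combination of confocal focused ellipses and hyperbolae as an integrable reflection wall.
   Context: The Kepler system has Hamiltonian (energy) $E=\frac{|p|^2}{2}-\frac{s}{|q|}$; $s$ may have either sign. A conic section is focused when the origin is a focus of it; confocal conic sections share the same pair of foci. A combination of curves means that the reflection wall is a union of such curves. A wall $\mathcal{B}$ is an integrable reflection wall if the mechanical billiard, in which the particle moves according to the system and is reflected elastically at $\mathcal{B}$ (tangential component of the momentum kept, normal component reversed), possesses for every energy $e\in\mathbb{R}$ an additional non-trivial first integral on $\{E=e\}$, independent of $E$, preserved by the motion and by the reflections at all curves of $\mathcal{B}$. It is not required that the billiard mapping be always well-defined. *)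

(* Defs.v *)
From mathcomp Require Import all_boot all_order all_algebra.
From mathcomp Require Import all_classical all_reals all_analysis.

Set Implicit Arguments.
Unset Strict Implicit.
Unset Printing Implicit Defensive.

Import Order.TTheory GRing.Theory Num.Theory.
Import numFieldNormedType.Exports.

Local Open Scope classical_set_scope.
Local Open Scope ring_scope.

(* The Euclidean plane C is identified with R * R.  The library norm `|q| on
   R * R is the sup norm: it only serves for the topology and for derivatives;
   the Euclidean length is enorm. *)
Notation plane R := (R * R)%type.

(* Points of the cotangent bundle of the plane: z.1 is the position q and
   z.2 the momentum p. *)
Notation phase R := (plane R * plane R)%type.

Section Definitions.
Variable R : realType.
Implicit Types (q p u v : plane R) (z : phase R) (C : set (plane R)).

Definition dot u v : R := u.1 * v.1 + u.2 * v.2.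

Definition enorm u : R := Num.sqrt (dot u u).

(* The major axis has length 2 a.  Coinciding foci are allowed and give
   circles; the degenerate case of a segment is excluded. *)
Definition is_ellipse (F1 F2 : plane R) C : Prop :=
  exists2 a : R, enorm (F1 - F2) < 2 * a
    & C = [set q | enorm (q - F1) + enorm (q - F2) = 2 * a].

(* Both branches; the degenerate cases of a line and of two rays are
   excluded. *)
Definition is_hyperbola (F1 F2 : plane R) C : Prop :=
  exists2 a : R, 0 < 2 * a < enorm (F1 - F2)
    & C = [set q | `| enorm (q - F1) - enorm (q - F2) | = 2 * a].

Definition tangent_vector C q v : Prop :=
  exists c : R -> plane R,
    [/\ c 0 = q, \forall t \near (0 : R), C (c t) & is_derive (0 : R) 1 c v].

Definition elastic_reflection C q p p' : Prop :=
  exists v, [/\ v != 0, tangent_vector C q v, dot p' v = dot p v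
    & forall n, dot n v = 0 -> dot p' n = - dot p n].

(* The position avoids the origin, where the force function is singular. *)
Definition phase_space : set (phase R) := [set z | z.1 != 0].

Definition kepler_energy (s : R) z : R := enorm z.2 ^+ 2 / 2 - s / enorm z.1.

Definition energy_level (H : phase R -> R) (e : R) : set (phase R) :=
  [set z | phase_space z /\ H z = e].

(* C^oo on an open set U: every iterated directional derivative of f is
   (Frechet) differentiable, hence continuous, on U. *)
Definition smooth_on (U : set (phase R)) (f : phase R -> R) : Prop :=
  forall (ws : seq (phase R)) z, U z ->
    differentiable (foldr (fun (w : phase R) (g : phase R -> R) => 'D_w g) f ws) z.

(* Hamilton's equations q' = dH/dp, p' = - dH/dq on the time interval ]a, b[,
   written as dH = omega (z', _) for the canonical symplectic form omega. *)
Definition hamiltonian_motion (H : phase R -> R) (a b : R) (z : R -> phase R) :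
    Prop :=
  forall t, a < t < b -> phase_space (z t) /\
    exists2 v : phase R, is_derive t 1 z v
      & forall w : phase R, 'd H (z t) w = dot v.1 w.2 - dot v.2 w.1.

Definition differentials_independent (H G : phase R -> R) z : Prop :=
  forall a b : R, (forall w : phase R, a * 'd H z w + b * 'd G z w = 0) ->
    a = 0 /\ b = 0.

(* Functional independence is required at a dense set of points of {H = e};
   nothing is required when {H = e} is empty (e.g. for a repulsive force and
   e <= 0). *)
Definition independent_on_level (H G : phase R -> R) (e : R) : Prop :=
  energy_level H e `<=`
    closure [set z | energy_level H e z /\ differentials_independent H G z].

Definition preserved_by_motion (H G : phase R -> R) (e : R) : Prop :=
  forall (a b : R) (z : R -> phase R), hamiltonian_motion H a b z ->
    (forall t, a < t < b -> energy_level H e (z t)) ->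
    forall t1 t2, a < t1 < b -> a < t2 < b -> G (z t1) = G (z t2).

Definition preserved_by_reflection (H G : phase R -> R) (e : R) C : Prop :=
  forall q p p', energy_level H e (q, p) -> elastic_reflection C q p p' ->
    G (q, p') = G (q, p).

(* The wall is given as the family B of its curves, so that at a point common
   to several of them the reflection at each one is taken into account.  The
   first integral may depend on the energy e. *)
Definition integrable_reflection_wall (H : phase R -> R)
    (B : set (set (plane R))) : Prop :=
  forall e : R, exists G : phase R -> R,
    [/\ smooth_on phase_space G, independent_on_level H G e,
        preserved_by_motion H G e
      & forall C, B C -> preserved_by_reflection H G e C].

End Definitions.

(* Main.v *)
Require Import Defs.
From mathcomp Require Import all_boot all_order all_algebra.
From mathcomp Require Import all_classical all_reals all_analysis.
From mathcomp Require Import ring lra.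

(* The angular momentum [L] and the Laplace-Runge-Lenz vector [A] are conserved
   by the Kepler flow, hence so is [G = L ^ 2 - f . A], which equals
   [L_0 L_f + s (f . q) / |q|] for the angular momenta [L_0] and [L_f] about the
   two foci [0] and [f].  At a point of a conic with these foci, the optical
   property exchanges the two focal lines, so the elastic reflection preserves
   [L_0 L_f] and therefore [G].  Rotating [q] alone preserves the energy, so [E]
   and [G] are independent wherever the derivative of [G] along this rotation
   does not vanish; this holds densely, as that derivative is a nonzero
   polynomial in a rational parameter of the direction of [p], as soon as
   [p <> 0] and [2 q <> f]. *)

Set Implicit Arguments.
Unset Strict Implicit.
Unset Printing Implicit Defensive.

Import Order.TTheory GRing.Theory Num.Theory.
Import numFieldNormedType.Exports.

Local Open Scope classical_set_scope.
Local Open Scope ring_scope.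

(** * Differentials of pointwise sums and products, and of the Euclidean length *)

Lemma is_diff_funD {K : numFieldType} {V W : normedModType K} (g h dg dh : V -> W) x :
  is_diff x g dg -> is_diff x h dh ->
  is_diff x (fun y => g y + h y) (fun w => dg w + dh w).
Proof. exact: is_diffD. Qed.

Lemma is_diff_funM {K : numFieldType} {V : normedModType K} (g h dg dh : V -> K) x :
  is_diff x g dg -> is_diff x h dh ->
  is_diff x (fun y => g y * h y) (fun w => g x * dh w + dg w * h x).
Proof.
move=> gd hd; apply: is_diff_eq (is_diffM gd hd) _.
by apply/funext => w; rewrite [in RHS](mulrC (dg w)).
Qed.

Section Plane.
Context {R : realType}.
Implicit Types (p q u v w : plane R) (t : R).

Definition cross u v : R := u.1 * v.2 - u.2 * v.1.

Lemma dot_ge0 u : 0 <= dot u u.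
Proof. by rewrite addr_ge0 // -expr2 sqr_ge0. Qed.

Lemma dot_gt0 u : u != 0 -> 0 < dot u u.
Proof.
move=> u0; rewrite lt_neqAle dot_ge0 andbT eq_sym; apply: contra u0.
case: u => a b; rewrite /dot /= -!expr2 paddr_eq0 ?sqr_ge0 // !sqrf_eq0.
by move=> /andP[/eqP -> /eqP ->].
Qed.

Lemma enorm_sqr u : enorm u ^+ 2 = dot u u.
Proof. by rewrite sqr_sqrtr ?dot_ge0. Qed.

Lemma enorm_gt0 u : u != 0 -> 0 < enorm u.
Proof. by move=> /dot_gt0; rewrite sqrtr_gt0. Qed.

Lemma enormZ (a : R) u : enorm (a *: u) = `|a| * enorm u.
Proof.
rewrite -sqrtr_sqr -sqrtrM ?sqr_ge0 //; congr Num.sqrt.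
by rewrite /dot /= /GRing.scale /=; ring.
Qed.

Lemma is_diff_fst {V W : normedModType R} (x : V * W) :
  is_diff x (fst : V * W -> V) fst.
Proof.
have cont : continuous (fst : V * W -> V) by move=> y; exact: cvg_fst.
by apply: DiffDef; [exact: linear_differentiable | exact: diff_lin].
Qed.

Lemma is_diff_snd {V W : normedModType R} (x : V * W) :
  is_diff x (snd : V * W -> W) snd.
Proof.
have cont : continuous (snd : V * W -> W) by move=> y; exact: cvg_snd.
by apply: DiffDef; [exact: linear_differentiable | exact: diff_lin].
Qed.

Lemma enorm_is_diff u : u != 0 ->
  is_diff u (@enorm R) (fun w => dot u w / enorm u).
Proof.
move=> u0.
have dot_diff : is_diff u (fun v => dot v v) (fun w => 2 * dot u w).
  have fd := is_diff_fst u; have sd := is_diff_snd u.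
  apply: is_diff_eq (is_diff_funD (is_diff_funM fd fd) (is_diff_funM sd sd)) _.
  by apply/funext => w; rewrite /dot; ring.
have sqrt_diff : is_diff (dot u u) Num.sqrt
    (fun h : R => h *: (2 * Num.sqrt (dot u u))^-1).
  have [sd sv] := is_derive1_sqrt (dot_gt0 u0).
  have sd' : differentiable Num.sqrt (dot u u) by exact/derivable1_diffP.
  by apply: DiffDef => //; rewrite diff1E // derive1E sv.
apply: is_diff_eq (is_diff_comp dot_diff sqrt_diff) _.
apply/funext => w; rewrite /= /GRing.scale /= -/(enorm u).
by have := enorm_gt0 u0 => /gt_eqF/negbT h; field.
Qed.

End Plane.

(** The first-order expansion of [h] at [x] is also one for [g], and such an expansion determines
    the differential. *)
Lemma near_eq_differentiable {K : numFieldType} {V W : normedModType K}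
    (g h : V -> W) (x : V) :
  {near x, g =1 h} -> differentiable h x -> differentiable g x.
Proof.
move=> gh hd; have [cont hx] := (diff_locallyP x h).1 hd.
have gx : g \o shift x = cst (g x) + 'd h x +o_ 0 id.
  apply/eqaddoP => eps eps0; move/eqaddoP: hx => /(_ eps eps0).
  have gh0 : \forall y \near 0, g (y + x) = h (y + x).
    by move: gh => /nbhs0P; apply: filterS => y; rewrite addrC.
  by apply: filterS2 gh0 => y /= e; rewrite !fctE /= e (nbhs_singleton gh).
by apply/diff_locallyP; rewrite (diff_unique cont gx).
Qed.

(** * Smoothness of polynomials in the coordinates and in 1/|q| *)

Section PolynomialsInvNorm.
Context {R : realType}.
Implicit Types (z w : phase R).

Lemma is_diff_inv_enorm z : phase_space z ->
  is_diff z (fun y => (enorm y.1)^-1)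
    (fun w => - dot z.1 w.1 * (enorm z.1)^-1 ^+ 3).
Proof.
move=> z0; have r0 : enorm z.1 != 0 by rewrite gt_eqF ?enorm_gt0.
have nd : is_diff z (fun y => enorm y.1) (fun w => dot z.1 w.1 / enorm z.1).
  exact: is_diff_comp (is_diff_fst z) (enorm_is_diff z0).
case: nd => nd nv.
apply: DiffDef; first exact: differentiableV nd r0.
rewrite (diffV nd r0) nv.
by apply/funext => w; rewrite /= /GRing.scale /=; field.
Qed.

(* Polynomials in the coordinates and in 1/|q|: reifying them makes their
   derivatives computable, and shows that they are again of this form. *)
Inductive expr : Type :=
| Cst of R
| Q1 | Q2 | P1 | P2
| InvNorm
| Add of expr & expr
| Mul of expr & expr.

Fixpoint eval (a : expr) : phase R -> R :=
  match a with
  | Cst c => fun=> c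
  | Q1 => fun z => z.1.1
  | Q2 => fun z => z.1.2
  | P1 => fun z => z.2.1
  | P2 => fun z => z.2.2
  | InvNorm => fun z => (enorm z.1)^-1
  | Add b c => fun z => eval b z + eval c z
  | Mul b c => fun z => eval b z * eval c z
  end.

Fixpoint deriv (w : phase R) (a : expr) : expr :=
  match a with
  | Cst _ => Cst 0
  | Q1 => Cst w.1.1
  | Q2 => Cst w.1.2
  | P1 => Cst w.2.1
  | P2 => Cst w.2.2
  | InvNorm => Mul (Add (Mul (Cst (- w.1.1)) Q1) (Mul (Cst (- w.1.2)) Q2))
                   (Mul InvNorm (Mul InvNorm InvNorm))
  | Add b c => Add (deriv w b) (deriv w c)
  | Mul b c => Add (Mul b (deriv w c)) (Mul (deriv w b) c)
  end.

Lemma eval_is_diff a z : phase_space z ->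
  is_diff z (eval a) (fun w => eval (deriv w a) z).
Proof.
move=> z0; elim: a => [c|||||||] /=.
- exact: is_diff_cst.
- exact: is_diff_comp (is_diff_fst z) (is_diff_fst _).
- exact: is_diff_comp (is_diff_fst z) (is_diff_snd _).
- exact: is_diff_comp (is_diff_snd z) (is_diff_fst _).
- exact: is_diff_comp (is_diff_snd z) (is_diff_snd _).
- apply: is_diff_eq (is_diff_inv_enorm z0) _.
  by apply/funext => w; rewrite /dot; ring.
- by move=> b bd c cd; exact: is_diff_funD.
- by move=> b bd c cd; exact: is_diff_funM.
Qed.

Lemma differentiable_eval a z : phase_space z -> differentiable (eval a) z.
Proof. by case/(eval_is_diff a). Qed.

Lemma diff_eval a z w : phase_space z -> 'd (eval a) z w = eval (deriv w a) z.
Proof. by case/(eval_is_diff a) => _ /(congr1 (@^~ w)). Qed.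

Lemma open_phase_space : open (@phase_space R).
Proof.
rewrite (_ : @phase_space R = fst @^-1` [set~ 0 : plane R]); last first.
  by apply/seteqP; split=> z /= /eqP.
apply: open_comp; first by move=> z _; exact: cvg_fst.
by apply: closed_openC; exact/accessible_closed_set1/hausdorff_accessible/norm_hausdorff.
Qed.

Lemma smooth_eval a : smooth_on (@phase_space R) (eval a).
Proof.
have near_phase z : phase_space z -> \near z, phase_space z.
  by move=> z0; apply: open_nbhs_nbhs; split=> //; exact: open_phase_space.
move=> ws z z0.
(* The iterated derivatives are given by expressions only where q is nonzero; as [phase_space] is
   open, this is agreement near [z], which suffices. *)
suff [b ab] : exists b, forall y, phase_space y ->
    foldr (fun (w : phase R) (g : phase R -> R) => 'D_w g) (eval a) ws y = eval b y.
  apply: near_eq_differentiable (differentiable_eval b z0).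
  by apply: filterS (near_phase z z0) => y /ab.
elim: ws => [|w ws [b eb]] /=; first by exists a.
exists (deriv w b) => y y0.
rewrite -diff_eval // -deriveE; last exact: differentiable_eval.
by apply: near_eq_derive; apply: filterS (near_phase y y0) => x /eb.
Qed.

End PolynomialsInvNorm.

Arguments expr : clear implicits.

(** * Conservation of the first integral along the Kepler flow *)

Section FirstIntegral.
Context {R : realType} (s : R) (f : plane R).
Implicit Types z v w : phase R.

Definition first_integral z : R :=
  cross z.1 z.2 * cross (z.1 - f) z.2 + s * dot f z.1 / enorm z.1.

Definition kepler_expr : expr R :=
  Add (Mul (Cst (1 / 2)) (Add (Mul P1 P1) (Mul P2 P2)))
      (Mul (Cst (- s)) InvNorm).

Definition first_integral_expr : expr R :=
  Add (Mul (Add (Mul Q1 P2) (Mul (Cst (-1)) (Mul Q2 P1)))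
           (Add (Mul (Add Q1 (Cst (- f.1))) P2)
                (Mul (Cst (-1)) (Mul (Add Q2 (Cst (- f.2))) P1))))
      (Mul (Mul (Cst s) (Add (Mul (Cst f.1) Q1) (Mul (Cst f.2) Q2)))
           InvNorm).

Lemma kepler_exprE : kepler_energy s = eval kepler_expr.
Proof.
by apply/funext => z; rewrite /kepler_energy enorm_sqr /dot /=; ring.
Qed.

Lemma first_integral_exprE : first_integral = eval first_integral_expr.
Proof.
by apply/funext => z; rewrite /first_integral /cross /dot /=; ring.
Qed.

Lemma diff_kepler z w : phase_space z ->
  'd (kepler_energy s) z w =
  dot z.2 w.2 + s * dot z.1 w.1 * (enorm z.1)^-1 ^+ 3.
Proof.
move=> z0; rewrite kepler_exprE.
rewrite diff_eval //=.
by rewrite /dot; move: (enorm z.1)^-1 => i; field.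
Qed.

Lemma diff_first_integral z w : phase_space z ->
  'd first_integral z w =
  cross z.1 z.2 * (cross w.1 z.2 + cross (z.1 - f) w.2)
  + (cross w.1 z.2 + cross z.1 w.2) * cross (z.1 - f) z.2
  + s * (dot f w.1 / enorm z.1
         - dot f z.1 * dot z.1 w.1 * (enorm z.1)^-1 ^+ 3).
Proof.
move=> z0; rewrite first_integral_exprE.
rewrite diff_eval //=.
by rewrite /dot /cross /=; ring.
Qed.

(** The canonical symplectic form is nondegenerate: testing on the four coordinate directions
    determines [v], which yields Newton's equation. *)
Lemma hamiltonian_kepler z v : phase_space z ->
  (forall w, 'd (kepler_energy s) z w = dot v.1 w.2 - dot v.2 w.1) ->
  v = (z.2, - (s * (enorm z.1)^-1 ^+ 3) *: z.1).
Proof.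
move=> z0 hv.
case: v hv => -[v1 v2] [v3 v4]; case: z z0 => -[q1 q2] [p1 p2] z0 hv.
have := hv ((1, 0), 0); have := hv ((0, 1), 0).
have := hv (0, (1, 0)); have := hv (0, (0, 1)).
rewrite !diff_kepler // /dot /= => e1 e2 e3 e4.
by congr ((_, _), (_, _)); rewrite /GRing.scale /=; lra.
Qed.

Lemma first_integral_stationary z v : phase_space z ->
  (forall w, 'd (kepler_energy s) z w = dot v.1 w.2 - dot v.2 w.1) ->
  'd first_integral z v = 0.
Proof.
move=> z0 /(hamiltonian_kepler z0) ->; rewrite diff_first_integral //=.
have inv_sqr : dot z.1 z.1 * (enorm z.1)^-1 ^+ 2 = 1.
  by rewrite -enorm_sqr -exprMn mulfV ?expr1n // gt_eqF ?enorm_gt0.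
(* Lagrange's identity expands the product of [cross z.1 z.2] and [cross z.1 f] into dot products;
   its part in [dot f z.1 * dot z.1 z.2] cancels against the derivative of 1/|q|. *)
transitivity (s * dot f z.2 / enorm z.1
              * (1 - dot z.1 z.1 * (enorm z.1)^-1 ^+ 2)).
  by rewrite /cross /dot /= /GRing.scale /=; ring.
by rewrite inv_sqr subrr mulr0.
Qed.

End FirstIntegral.

(** By the chain rule [G \o z] has zero derivative along a motion, so the mean value theorem makes
    it constant. *)
Lemma preserved_by_motion_stationary {R : realType} (H G : phase R -> R) (e : R) :
  (forall z, phase_space z -> differentiable G z) ->
  (forall z v, phase_space z ->
    (forall w, 'd H z w = dot v.1 w.2 - dot v.2 w.1) -> 'd G z v = 0) ->
  preserved_by_motion H G e.
Proof.
move=> Gd stat a b z zH _.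
have Gz_is0 t : a < t < b -> is_derive t (1 : R) (G \o z) 0.
  move=> /zH[z0 [v [zd zv] vH]].
  have zd' : differentiable z t by exact/derivable1_diffP.
  have Gzd : differentiable (G \o z) t.
    by apply: differentiable_comp => //; exact: Gd.
  apply: DeriveDef; first exact/derivable1_diffP.
  rewrite deriveE // diff_comp //=; last exact: Gd.
  by rewrite -(deriveE _ zd') zv; exact: stat vH.
move=> t1 t2; wlog le12 : t1 t2 / t1 <= t2.
  by move=> wl h1 h2; case/orP: (le_total t1 t2) => ?; [|apply/esym]; exact: wl.
move=> /andP[at1 _] /andP[_ t2b].
have in_ab t : t \in `[t1, t2] -> a < t < b.
  by rewrite in_itv /= => /andP[/(lt_le_trans at1) -> /le_lt_trans ->].
have [t tI|//|c _] := @MVT_segment R (G \o z) (fun=> 0) t1 t2 le12.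
- by apply: Gz_is0; apply: in_ab; exact: subset_itv_oo_cc.
- apply: derivable_within_continuous => t /in_ab /Gz_is0 d.
  exact: ex_derive.
- by rewrite mul0r => /eqP; rewrite subr_eq0 => /eqP.
Qed.

(** * Elastic reflection at conics with foci 0 and f *)

Section Reflection.
Context {R : realType} (s : R) (f : plane R).
Implicit Types (q p u v w : plane R).

(* With [eps = 1] for ellipses and [eps = -1] for hyperbolae, [v] is orthogonal
   to [q / |q| + eps * (q - f) / |q - f|], so the reflection maps the line
   through [q] and one focus to the line through [q] and the other one. *)
Lemma focal_reflection (eps : R) q p p' v :
  eps ^+ 2 = 1 -> q != 0 -> q - f != 0 -> v != 0 ->
  dot f f != (enorm q + eps * enorm (q - f)) ^+ 2 ->
  dot q v / enorm q + eps * (dot (q - f) v / enorm (q - f)) = 0 ->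
  dot p' v = dot p v -> (forall n, dot n v = 0 -> dot p' n = - dot p n) ->
  cross q p' * cross (q - f) p' = cross q p * cross (q - f) p.
Proof.
move=> eps2 q0 qf0 v0 nondeg tangent ptan pnor.
set q' := q - f in qf0 nondeg tangent *.
have r1 : enorm q != 0 by rewrite gt_eqF ?enorm_gt0.
have r2 : enorm q' != 0 by rewrite gt_eqF ?enorm_gt0.
have s1 := enorm_sqr q; have s2 := enorm_sqr q'.
have N0 : dot v v != 0 by rewrite gt_eqF ?dot_gt0.
move: (enorm q) (enorm q') r1 r2 s1 s2 nondeg tangent => r r' r1 r2 s1 s2 nd tg.
have {}tg : r' * dot q v = - eps * r * dot q' v.
  apply/eqP; rewrite -subr_eq0; apply/eqP.
  transitivity (r * r' * (dot q v / r + eps * (dot q' v / r'))); last first.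
    by rewrite tg mulr0.
  by field; rewrite r1 r2.
have pyth u : cross u v ^+ 2 = dot u u * dot v v - dot u v ^+ 2.
  by rewrite /cross /dot; ring.
(* The tangential components of q / r and q' / r' agree up to sign by [tg]; both vectors having unit
   length, so do the normal ones. *)
have : (r' * cross q v) ^+ 2 == (eps * r * cross q' v) ^+ 2.
  apply/eqP; transitivity (r' ^+ 2 * r ^+ 2 * dot v v - (r' * dot q v) ^+ 2).
    by rewrite !exprMn pyth s1; ring.
  transitivity (eps ^+ 2 * r ^+ 2 * (r' ^+ 2 * dot v v - dot q' v ^+ 2)).
    by rewrite tg !exprMn sqrrN eps2; ring.
  by rewrite !exprMn pyth s2; ring.
(* If the normal components carried the same sign as in [tg], then r' q = - eps r q', hence |f|^2 =
   (r + eps r')^2, the degenerate case. The remaining sign makes the two focal lines mirror images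
   in the tangent. *)
rewrite eqf_sqr => /orP[/eqP cc|/eqP cc]; last first.
  case/negP: nd; apply/eqP.
  have dd : dot q q' = - eps * r * r'.
    apply: (mulIf N0); apply: (mulfI r2).
    transitivity (r' * dot q v * dot q' v + r' * cross q v * cross q' v).
      by rewrite /dot /cross; ring.
    rewrite tg cc; transitivity (- eps * r * (cross q' v ^+ 2 + dot q' v ^+ 2)).
      by ring.
    by rewrite pyth subrK -s2; ring.
  have -> : dot f f = dot q q - 2 * dot q q' + dot q' q'.
    by rewrite /q' /dot /=; ring.
  rewrite dd -s1 -s2 sqrrD exprMn eps2; ring.
(* This is the coefficient of the mixed term [dot p v * dot p Jv] in the product of the angular
   momenta, the only term whose sign the reflection changes. *)
have opposite : cross q v * dot q' v + dot q v * cross q' v = 0.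
  apply: (mulfI r2); rewrite mulr0 mulrDr !mulrA cc tg; ring.
set Jv : plane R := (- v.2, v.1).
have {}pnor : dot p' Jv = - dot p Jv by apply: pnor; rewrite /dot /=; ring.
have decomp u x : dot v v * cross u x = dot x v * cross u v + dot x Jv * dot u v.
  by rewrite /dot /cross /=; ring.
apply: (mulfI N0); apply: (mulfI N0).
have split x : dot v v * (dot v v * (cross q x * cross q' x)) =
    (dot v v * cross q x) * (dot v v * cross q' x) by ring.
rewrite !split !decomp ptan pnor.
apply/eqP; rewrite -subr_eq0; apply/eqP.
transitivity (- 2 * dot p v * dot p Jv *
  (cross q v * dot q' v + dot q v * cross q' v)); first by ring.
by rewrite opposite mulr0.
Qed.

Lemma is_derive_enorm_sub (c : R -> plane R) g v :
  c 0 - g != 0 -> is_derive (0 : R) 1 c v ->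
  is_derive (0 : R) 1 (fun t => enorm (c t - g)) (dot (c 0 - g) v / enorm (c 0 - g)).
Proof.
move=> cg0 [cd cv].
have cdiff : differentiable c 0 by exact/derivable1_diffP.
have subd : is_diff (0 : R) (fun t => c t - g) ('d c 0 : R -> plane R).
  apply: is_diff_eq (is_diff_funD (differentiableP cdiff) (is_diff_cst (- g) 0)) _.
  by apply/funext => w; rewrite addr0.
have [nd nv] := is_diff_comp subd (enorm_is_diff cg0).
apply: DeriveDef; first exact/derivable1_diffP.
by rewrite (deriveE _ nd) nv /= -(deriveE _ cdiff) cv.
Qed.

(** Squaring the focal equation treats ellipses and both branches of hyperbolae at once and removes
    the absolute value; [eps] is the sign between the two focal distances. *)
Lemma focal_conic_reflection (H : phase R -> R) (e eps k : R) C :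
  eps ^+ 2 = 1 -> k != 0 -> dot f f != k ^+ 2 ->
  (forall q, C q -> (enorm q + eps * enorm (q - f)) ^+ 2 = k ^+ 2) ->
  preserved_by_reflection H (first_integral s f) e C.
Proof.
move=> eps2 k0 nondeg conic q p p' _ [v [v0 [c [c0 cC cd]] ptan pnor]].
have Cq : (enorm q + eps * enorm (q - f)) ^+ 2 = k ^+ 2.
  by apply: conic; rewrite -c0; exact: nbhs_singleton cC.
(* A focus lying on the curve would give [dot f f = k ^+ 2]; so both focal distances are
   differentiable at q. *)
have q0 : q != 0.
  apply: contra nondeg => /eqP q0; rewrite -Cq q0 {1}/enorm /dot /= !mulr0 addr0.
  rewrite sqrtr0 add0r exprMn eps2 mul1r enorm_sqr.
  by apply/eqP; rewrite /dot /=; ring.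
have qf0 : q - f != 0.
  apply: contra nondeg => /eqP qf0; move: Cq; rewrite qf0 {2}/enorm /dot /=.
  rewrite !mulr0 addr0 sqrtr0 mulr0 addr0 enorm_sqr => <-.
  by rewrite (subr0_eq qf0) eqxx.
rewrite /first_integral /=; congr (_ + _).
apply: (@focal_reflection eps q p p' v); rewrite ?Cq //.
have d1 : is_derive (0 : R) 1 (fun t => enorm (c t - 0)) (dot q v / enorm q).
  have := @is_derive_enorm_sub c 0 v; rewrite c0 subr0; exact.
have d2 : is_derive (0 : R) 1 (fun t => enorm (c t - f))
    (dot (q - f) v / enorm (q - f)).
  by have := @is_derive_enorm_sub c f v; rewrite c0; exact.
(* [S ^+ 2] is constant along the curve near 0, so 2 S S' = 0 there; since [k != 0] rules out S = 0,
   this leaves the tangency condition S' = 0. *)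
set S := (fun t : R => enorm (c t - 0)) + eps *: (fun t : R => enorm (c t - f)).
have dS := is_deriveX 2 (is_deriveD d1 (is_deriveZ eps d2) : is_derive _ _ S _).
have Sk : \forall t \near (0 : R), (S ^+ 2) t = cst (k ^+ 2) t.
  apply: filterS cC => t /conic <-.
  by rewrite /S !fctE /GRing.scale /= subr0.
have := @derive_val _ _ _ _ _ _ _ (near_eq_is_derive Sk dS).
rewrite derive_cst => /esym/eqP.
rewrite scaler_eq0 mulf_eq0 pnatr_eq0 expf_eq0 /= => /orP[S0|/eqP //].
case/negP: k0; rewrite -sqrf_eq0 -Cq sqrf_eq0.
by move: S0; rewrite /S !fctE /GRing.scale /= subr0 c0.
Qed.

Lemma ellipse_reflection (H : phase R -> R) (e : R) C :
  is_ellipse 0 f C -> preserved_by_reflection H (first_integral s f) e C.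
Proof.
move=> [a fa ->]; have f0 : enorm (0 - f) ^+ 2 = dot f f.
  by rewrite enorm_sqr /dot /=; ring.
have f_ge0 : 0 <= enorm (0 - f) by exact: sqrtr_ge0.
apply: (@focal_conic_reflection _ _ 1 (2 * a)); rewrite ?expr1n //.
- by rewrite gt_eqF // (le_lt_trans f_ge0).
- by rewrite -f0 eqrXn2 ?lt_eqF //; lra.
- by move=> q /= <-; rewrite subr0 mul1r.
Qed.

Lemma hyperbola_reflection (H : phase R -> R) (e : R) C :
  is_hyperbola 0 f C -> preserved_by_reflection H (first_integral s f) e C.
Proof.
move=> [a /andP[a0 af] ->]; have f0 : enorm (0 - f) ^+ 2 = dot f f.
  by rewrite enorm_sqr /dot /=; ring.
apply: (@focal_conic_reflection _ _ (-1) (2 * a)); rewrite ?sqrrN ?expr1n //.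
- by rewrite gt_eqF.
- by rewrite -f0 eqrXn2 ?gt_eqF //; lra.
- by move=> q /= <-; rewrite subr0 mulN1r real_normK ?num_real.
Qed.

End Reflection.

(** * Density of the independence points on each energy level *)

Section Independence.
Context {R : realType} (s : R) (f : plane R).
Implicit Types (q p u v : plane R) (z w : phase R) (t : R).

Definition turn u : plane R := (- u.2, u.1).

(* Rational parametrization of the rotations, so that expressions
   polynomial in [rot t u] become polynomials in [t] after clearing denominators. *)
Definition rot t u : plane R :=
  (1 + t ^+ 2)^-1 *: ((1 - t ^+ 2) *: u + (2 * t) *: turn u).

Lemma sqr_add1_neq0 t : 1 + t ^+ 2 != 0.
Proof. by rewrite gt_eqF // ltr_wpDr ?sqr_ge0. Qed.

Lemma rot0 u : rot 0 u = u.
Proof.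
by rewrite /rot expr0n /= addr0 subr0 invr1 mulr0 scale0r addr0 !scale1r.
Qed.

Lemma dot_rot t u : dot (rot t u) (rot t u) = dot u u.
Proof.
by have := sqr_add1_neq0 t; rewrite /rot /dot /= /GRing.scale /= => h; field.
Qed.

Lemma enorm_rot t u : enorm (rot t u) = enorm u.
Proof. by rewrite /enorm dot_rot. Qed.

Lemma rot_eq0 t u : (rot t u == 0) = (u == 0).
Proof.
have enorm_eq0 v : (v == 0) = (enorm v == 0).
  apply/eqP/eqP => [->|v0]; first by rewrite /enorm /dot /= !mulr0 addr0 sqrtr0.
  by apply/eqP; apply: contraTT isT => /enorm_gt0; rewrite v0 ltxx.
by rewrite !enorm_eq0 enorm_rot.
Qed.

Lemma rot_neq t u : t != 0 -> u != 0 -> rot t u != u.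
Proof.
move=> t0 u0; apply/eqP => ru; have N0 := dot_gt0 u0.
have : dot u u - dot (rot t u) u = 0 by rewrite ru subrr.
have -> : dot u u - dot (rot t u) u = 2 * t ^+ 2 / (1 + t ^+ 2) * dot u u.
  by have := sqr_add1_neq0 t; rewrite /rot /dot /= /GRing.scale /= => h; field.
move/eqP; rewrite !mulf_eq0 invr_eq0 (negPf (sqr_add1_neq0 t)).
rewrite (negPf t0) pnatr_eq0 (gt_eqF N0). by [].
Qed.

Lemma continuous_pair (T U V : topologicalType) (g : T -> U) (h : T -> V) x :
  {for x, continuous g} -> {for x, continuous h} ->
  {for x, continuous (fun y => (g y, h y))}.
Proof. by move=> gc hc; exact: (cvg_pair gc hc). Qed.

Lemma continuous_fraction (P Q : {poly R}) t : Q.[t] != 0 ->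
  {for t, continuous (fun x => P.[x] / Q.[x])}.
Proof.
move=> Q0; apply: cvgM; first exact: continuous_horner.
by apply: cvgV => //; exact: continuous_horner.
Qed.

Lemma continuous_rot u t : {for t, continuous (rot^~ u)}.
Proof.
pose Q : {poly R} := 1 + 'X^2.
have Q0 : Q.[t] != 0 by rewrite !hornerE sqr_add1_neq0.
pose P a b : {poly R} := (1 - 'X^2) * a%:P + 2 *: 'X * b%:P.
have -> : rot^~ u = fun x => ((P u.1 (- u.2)).[x] / Q.[x], (P u.2 u.1).[x] / Q.[x]).
  apply/funext => x; rewrite /rot /GRing.scale /= /GRing.scale /= !hornerE.
  by congr (_, _); rewrite /scale_pair /= /GRing.scale /=; ring.
by apply: continuous_pair; exact: continuous_fraction.
Qed.

Lemma poly_nonroot_near0 (P : {poly R}) eps : P != 0 -> 0 < eps ->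
  exists2 t, 0 < t < eps & P.[t] != 0.
Proof.
move=> P0 eps0; apply: contrapT => noroot.
(* These are [size P] distinct points, more than [P] can have roots; denominators start at 2 to stay
   strictly below [eps]. *)
pose x i := eps / i.+2%:R.
pose rs := [seq x i | i <- iota 0 (size P)].
suff : (size rs < size P)%N by rewrite size_map size_iota ltnn.
apply: max_poly_roots => //.
  apply/allP => _ /mapP[i _ ->]; apply: contrapT => /negP xi; apply: noroot.
  exists (x i); last by [].
  rewrite divr_gt0 //= ltr_pdivrMr // ltr_pMr //.
  by rewrite ltr1n.
rewrite map_inj_uniq ?iota_uniq // => i j /(mulfI (lt0r_neq0 eps0)) /invr_inj.
by move=> /eqP; rewrite eqr_nat => /eqP[].
Qed.

Lemma closure_path (T : topologicalType) (g : R -> T) (A : set T) :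
  {for 0, continuous g} ->
  (forall eps, 0 < eps -> exists2 t, 0 < t < eps & A (g t)) -> closure A (g 0).
Proof.
move=> gc Ag B /gc /nbhs_ballP[eps /= eps0 epsB].
have [t /andP[t0 te] At] := Ag eps eps0.
exists (g t); split=> //; apply: epsB.
by rewrite /ball /= sub0r normrN gtr0_norm.
Qed.

(* The derivative of [first_integral] along the rotation of [q] alone. *)
Definition rotation_defect q p : R :=
  cross (turn q) p * cross (2 *: q - f) p + s * dot f (turn q) / enorm q.

(** Along [(turn q, 0)] the energy is stationary, so a nonzero defect forces b = 0; along the radial
    direction [(q, 0)] the energy varies at rate s / |q|, which forces a = 0. *)
Lemma independent_of_defect q p : s != 0 -> q != 0 -> rotation_defect q p != 0 ->
  differentials_independent (kepler_energy s) (first_integral s f) (q, p).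
Proof.
move=> s0 q0 defect a b ab.
have z0 : phase_space (q, p) by [].
have r0 : enorm q != 0 by rewrite gt_eqF ?enorm_gt0.
have b0 : b = 0.
  apply: (mulIf defect); rewrite mul0r.
  have := ab (turn q, 0); rewrite diff_kepler // diff_first_integral // => <-.
  by rewrite /rotation_defect /dot /cross /= /GRing.scale /=; ring.
split=> //; have := ab (q, 0).
rewrite b0 mul0r addr0 diff_kepler //= -enorm_sqr => /eqP.
have -> : dot p 0 + s * enorm q ^+ 2 * (enorm q)^-1 ^+ 3 = s / enorm q.
  by rewrite /dot /= !mulr0 !add0r; field.
by rewrite !mulf_eq0 invr_eq0 (negPf s0) (negPf r0) !orbF => /eqP.
Qed.

Lemma rotation_defect_near0 q p eps : q != 0 -> p != 0 -> 2 *: q != f -> 0 < eps ->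
  exists2 t, 0 < t < eps & rotation_defect q (rot t p) != 0.
Proof.
move=> q0 p0 qf eps0.
set u := turn q; set v := 2 *: q - f; set k := s * dot f u / enorm q.
(* [lin a] is the numerator of [cross a (rot t p)], and [P] that of the defect, over the
   denominators 1 + t^2 and (1 + t^2)^2. *)
pose lin a : {poly R} :=
  (1 - 'X^2) * (cross a p)%:P + 2 *: 'X * (cross a (turn p))%:P.
pose P : {poly R} := lin u * lin v + (1 + 'X^2) ^+ 2 * k%:P.
have linX a t : (lin a).[t] = (1 - t ^+ 2) * cross a p + 2 * t * cross a (turn p).
  by rewrite /lin !hornerE.
have PX t : P.[t] = (lin u).[t] * (lin v).[t] + (1 + t ^+ 2) ^+ 2 * k.
  have sqX : (1 + 'X^2 : {poly R}).[t] = 1 + t ^+ 2 by rewrite !hornerE.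
  by rewrite /P hornerD hornerM hornerM horner_exp sqX hornerC.
have PE t : P.[t] = (1 + t ^+ 2) ^+ 2 * rotation_defect q (rot t p).
  have h := sqr_add1_neq0 t.
  have linE a : (lin a).[t] = (1 + t ^+ 2) * cross a (rot t p).
    by rewrite linX /cross /rot /= /GRing.scale /=; field.
  by rewrite PX !linE /rotation_defect -/u -/v -/k; ring.
have [P0|P0] := eqVneq P 0; last first.
  have [t te Pt] := poly_nonroot_near0 P0 eps0; exists t => //.
  by apply: contra Pt => /eqP d0; rewrite PE d0 mulr0.
have Px t : P.[t] = 0 by rewrite P0 horner0.
have pyth a : cross a p ^+ 2 + cross a (turn p) ^+ 2 = dot a a * dot p p.
  by rewrite /cross /dot /turn /=; ring.
have Nu : 0 < dot u u.
  by have := dot_gt0 q0; rewrite /u /turn /dot /= mulrNN addrC.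
have Nv : 0 < dot v v by apply: dot_gt0; rewrite subr_eq0.
have := mulr_gt0 (mulr_gt0 Nu (dot_gt0 p0)) (mulr_gt0 Nv (dot_gt0 p0)).
rewrite -!pyth.
(* The values at 0 and 1 give a b = a' b' = - k, and then the value at 2 gives a b' + a' b = 0. So
   (a + i a') (b + i b') = 0 as complex numbers, although both factors have positive squared modulus
   by [pyth]. *)
have := Px 0; have := Px 1; have := Px 2; rewrite !PX !linX.
move: (cross u p) (cross u (turn p)) (cross v p) (cross v (turn p)) => a a' b b'.
move=> P2 P1 P0' lt0.
have re : a * b - a' * b' = 0 by lra.
have im : a * b' + a' * b = 0 by lra.
suff e : (a ^+ 2 + a' ^+ 2) * (b ^+ 2 + b' ^+ 2) = 0 by rewrite e ltxx in lt0.
transitivity ((a * b - a' * b') ^+ 2 + (a * b' + a' * b) ^+ 2); first by ring.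
by rewrite re im expr0n /= addr0.
Qed.

(** Three successive approximations inside the level: generic points [B] by independence points,
    points [A] with nonzero momentum by [B], and arbitrary points by [A]. *)
Lemma independent_on_kepler_level (e : R) : s != 0 ->
  independent_on_level (kepler_energy s) (first_integral s f) e.
Proof.
rewrite /independent_on_level => s0; set I := (X in closure X).
pose A := [set z | energy_level (kepler_energy s) e z /\ z.2 != 0].
pose B := [set z | A z /\ 2 *: z.1 != f].
have clcl (S : set (phase R)) : S `<=` closure I -> closure S `<=` closure I.
  by move=> /closureS; rewrite -((closure_id _).1 (@closed_closure _ I)).
have BI : B `<=` closure I.
  (* Rotating p keeps |p|, hence the energy. *)
  move=> [q p] [[[/= q0 He] p0] qf]; rewrite -(rot0 p).
  apply: (@closure_path _ (fun t => (q, rot t p))).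
    by apply: continuous_pair; [exact: cvg_cst | exact: continuous_rot].
  move=> eps eps0; have [t te d] := rotation_defect_near0 q0 p0 qf eps0.
  exists t => //; split; last exact: independent_of_defect.
  by split=> //; rewrite -He /kepler_energy /= enorm_rot.
have AI : A `<=` closure I.
  apply: subset_trans (clcl _ BI) => -[q p] [[/= q0 He] p0].
  have [qf|qf] := eqVneq (2 *: q) f; last exact: subset_closure.
  (* When 2 q = f, a small rotation of q leaves this exceptional position and keeps |q|, hence the
     energy. *)
  rewrite -(rot0 q); apply: (@closure_path _ (fun t => (rot t q, p))).
    by apply: continuous_pair; [exact: continuous_rot | exact: cvg_cst].
  move=> eps eps0; exists (eps / 2); first by lra.
  have t0 : eps / 2 != 0 by rewrite gt_eqF // divr_gt0.
  split; last first.
    rewrite -qf; apply: contra (rot_neq t0 q0) => /eqP.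
    by move/(scalerI (lt0r_neq0 (ltr0Sn _ 1))) => /= ->.
  split=> //; split; first by rewrite /phase_space /= rot_eq0.
  by rewrite -He /kepler_energy /= enorm_rot.
apply: subset_trans (clcl _ AI) => -[q p] [/= q0 He].
have [p0|p0] := eqVneq p 0; last exact: subset_closure.
have r_gt0 := enorm_gt0 q0; set r := enorm q in r_gt0.
(* At rest, the momentum (t, 0) adds t^2 / 2 to the energy; dividing q by 1 + k t^2 changes the
   potential by - s k t^2 / r, which compensates exactly for this [k]. *)
pose k := r / (2 * s).
pose g t : phase R := ((1 + k * t ^+ 2)^-1 *: q, (t, 0)).
have -> : (q, p) = g 0.
  by rewrite /g expr0n mulr0 addr0 invr1 scale1r p0.
apply: closure_path.
  apply: continuous_pair; last first.
    by apply: continuous_pair; [exact: cvg_id | exact: cvg_cst].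
  apply: continuousZr_tmp; apply: continuousV.
    by rewrite expr0n mulr0 addr0 oner_neq0.
  have -> : (fun t : R => 1 + k * t ^+ 2) = horner (1 + k *: 'X^2).
    by apply/funext => t; rewrite !hornerE.
  exact: continuous_horner.
move=> eps eps0.
have k1 : 0 < 1 + `|k| by rewrite ltr_wpDr.
(* The second bound gives |k| t^2 < 1, which keeps the scaling factor positive. *)
pose t := Num.min (eps / 2) (1 + `|k|)^-1.
have t0 : 0 < t by rewrite lt_min divr_gt0 // invr_gt0.
have te : t < eps by rewrite gt_min; apply/orP; left; lra.
have tk : t * (1 + `|k|) <= 1 by rewrite -ler_pdivlMr // mul1r ge_min lexx orbT.
have lam0 : 0 < 1 + k * t ^+ 2.
  have kk : - `|k| <= k by rewrite lerNl ler_normr lexx orbT.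
  have k_ge0 := normr_ge0 k.
  have : - `|k| * t ^+ 2 <= k * t ^+ 2 by rewrite ler_wpM2r // sqr_ge0.
  nra.
exists t; first by rewrite t0.
rewrite /A /energy_level /phase_space /kepler_energy /=; split; last first.
  by apply/eqP => -[] /eqP; rewrite gt_eqF.
split; first by rewrite scaler_eq0 invr_eq0 gt_eqF.
have -> : enorm ((1 + k * t ^+ 2)^-1 *: q) = (1 + k * t ^+ 2)^-1 * r.
  by rewrite enormZ gtr0_norm ?invr_gt0.
move: He; rewrite p0 /kepler_energy /= !enorm_sqr /dot /= -/r => <-.
by rewrite invfM invrK /k; field; rewrite s0 gt_eqF.
Qed.

End Independence.

Theorem corollary3 (R : realType) (s : R) (hs : s != 0) (f : plane R)
    (B : set (set (plane R)))
    (hB : forall C : set (plane R), B C -> is_ellipse 0 f C \/ is_hyperbola 0 f C) :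
  integrable_reflection_wall (kepler_energy s) B.
Proof.
move=> e; exists (first_integral s f); split.
- by rewrite first_integral_exprE; exact: smooth_eval.
- exact: independent_on_kepler_level.
- apply: preserved_by_motion_stationary; last exact: first_integral_stationary.
  by move=> z z0; rewrite first_integral_exprE; exact: differentiable_eval.
- by move=> C /hB[]; [exact: ellipse_reflection | exact: hyperbola_reflection].
Qed.
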